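(* Let $G$ be a graph with no isolated vertex and let $H$ be a graph (with no isolated vertex) such that $\gamma_t(H)=\gamma(H)$. Then: (i) for any TRDF $f$ on $G$ of weight $\gamma_{tR}(G)$, with $V_2=\{x\in V(G): f(x)=2\}$, we have $\gamma_{R}(G\times H)\leq 2\gamma(H)(\gamma_{tR}(G)-|V_2|)$; (ii) if there exists a TRDF $f$ on $G$ of weight $\gamma_{tR}(G)$ such that $V_2=\{x: f(x)=2\}$ is a dominating set of $G$, then $\gamma_{R}(G\times H)\leq 2\gamma(H)(\gamma_{tR}(G)-\gamma(G))$.
   Context: All graphs are finite and simple. The direct product $G\times H$ has vertex set $V(G)\times V(H)$, with $(u,v)$ adjacent to $(u',v')$ iff $uu'\in E(G)$ and $vv'\in E(H)$. A set $S$ is dominating if every vertex is in $S$ or adjacent to a vertex of $S$; $\gamma(G)$ is the minimum size of a dominating set. A set $D$ is total dominating if every vertex of $G$ has a neighbor in $D$; $\gamma_t(G)$ is the minimum size of a total dominating set. For $f:V(G)\to\{0,1,2\}$ write $V_i=\{v:f(v)=i\}$ and $\omega(f)=|V_1|+2|V_2|$. $f$ is a Roman dominating function (RDF) if every vertex in $V_0$ has a neighbor in $V_2$; $\gamma_R(G)$ is the minimum weight of an RDF. An RDF is a total Roman dominating function (TRDF) if the subgraph induced by $V_1\cup V_2$ has no isolated vertices; $\gamma_{tR}(G)$ is the minimum weight of a TRDF. *)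

(* Defs.v *)
From mathcomp Require Import all_boot.
Set Implicit Arguments.
Unset Strict Implicit.
Unset Printing Implicit Defensive.

Record sgraph := SGraph {
  vertex :> finType;
  adj : rel vertex;
  adj_sym : symmetric adj;
  adj_irrefl : irreflexive adj }.

Section DirectProduct.
Variables G H : sgraph.

Definition dprod_adj : rel (G * H) :=
  fun x y => adj x.1 y.1 && adj x.2 y.2.

Lemma dprod_adj_sym : symmetric dprod_adj.
Proof. by move=> x y; rewrite /dprod_adj (adj_sym x.1) (adj_sym x.2). Qed.

Lemma dprod_adj_irrefl : irreflexive dprod_adj.
Proof. by move=> x; rewrite /dprod_adj adj_irrefl. Qed.

Definition direct_product : sgraph := SGraph dprod_adj_sym dprod_adj_irrefl.
End DirectProduct.

Section Domination.
Variable G : sgraph.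
Implicit Types (S D A : {set G}) (f : {ffun G -> 'I_3}).

Definition induced_no_isolated A :=
  [forall v in A, exists u in A, adj v u].

Definition no_isolated := induced_no_isolated [set: G].

Definition dominating S :=
  [forall v, (v \in S) || [exists u in S, adj v u]].

Definition total_dominating D := [forall v, exists u in D, adj v u].

Definition level f (i : nat) : {set G} := [set v | f v == i :> nat].

Definition weight f := #|level f 1| + 2 * #|level f 2|.

Definition RDF f :=
  [forall v in level f 0, exists u in level f 2, adj v u].

Definition TRDF f :=
  RDF f && induced_no_isolated (level f 1 :|: level f 2).

Definition const_one : {ffun G -> 'I_3} := [ffun=> inord 1].

(* The minima below start the search from a default candidate, [set: G] or the
   constant function 1.  It is always dominating, resp. an RDF; it is total
   dominating, resp. a TRDF, exactly when G has no isolated vertex.  If G has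
   an isolated vertex, there is no total dominating set and no TRDF, and gamma_t
   and gamma_tR take the meaningless value #|G|. *)
Definition gamma := #|[arg min_(S < [set: G] | dominating S) #|S|]|.

Definition gamma_t := #|[arg min_(D < [set: G] | total_dominating D) #|D|]|.

Definition gamma_R := weight [arg min_(f < const_one | RDF f) weight f].

Definition gamma_tR := weight [arg min_(f < const_one | TRDF f) weight f].
End Domination.

(* Main.v *)
Require Import Defs.
From mathcomp Require Import all_boot.

(** The positive vertices [V_1 :|: V_2] of a TRDF [f] form a total dominating
set of [G] of size [weight f - |V_2|]. Its product with a minimum total
dominating set of [H] totally dominates the direct product, and giving value 2
to every vertex of a dominating set yields an RDF. *)

Section MinimaBounds.
Variable G : sgraph.
Implicit Types (S D : {set G}) (f : {ffun G -> 'I_3}).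

Lemma gamma_le S : dominating S -> gamma G <= #|S|.
Proof.
rewrite /gamma; case: arg_minnP => [|T _ minT /minT //].
by apply/forallP=> v; rewrite inE.
Qed.

Lemma gamma_R_le f : RDF f -> gamma_R G <= weight f.
Proof.
rewrite /gamma_R; case: arg_minnP => [|g _ ming /ming //].
by apply/forallP=> v; rewrite inE ffunE inordK.
Qed.

(** Without isolated vertices the default candidate [[set: G]] is itself total dominating, so the
    minimum is attained by a genuine total dominating set. *)
Lemma gamma_t_witness :
  no_isolated G -> exists2 D : {set G}, total_dominating D & #|D| = gamma_t G.
Proof.
move=> /forallP hG; rewrite /gamma_t.
case: arg_minnP => [|D tdD _]; last by exists D.
by apply/forallP=> v; have := hG v; rewrite inE.
Qed.

Lemma total_dominating_dominating D : total_dominating D -> dominating D.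
Proof. by move=> /forallP tdD; apply/forallP=> v; rewrite tdD orbT. Qed.

Lemma gamma_R_le_double S : dominating S -> gamma_R G <= 2 * #|S|.
Proof.
move=> /forallP domS.
pose f : {ffun G -> 'I_3} := [ffun v => inord (if v \in S then 2 else 0)].
have fE v : f v = (if v \in S then 2 else 0) :> nat.
  by rewrite ffunE inordK //; case: ifP.
have f1 : level f 1 = set0.
  by apply/setP=> v; rewrite !inE fE; case: ifP.
have f2 : level f 2 = S.
  by apply/setP=> v; rewrite !inE fE; case: ifP.
have <- : weight f = 2 * #|S| by rewrite /weight f1 f2 cards0.
apply: gamma_R_le; rewrite /RDF f2; apply/forallP=> v; apply/implyP.
by rewrite inE fE; have := domS v; case: (v \in S).
Qed.

(** A vertex of positive value has a positive neighbor because the induced subgraph has no isolated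
    vertex; a vertex of value 0 has a neighbor of value 2 by the Roman condition. *)
Lemma TRDF_total_dominating f :
  TRDF f -> total_dominating (level f 1 :|: level f 2).
Proof.
case/andP=> /forall_inP rdf /forall_inP niso; apply/forallP=> v.
have [/niso //|v0] := boolP (v \in level f 1 :|: level f 2).
have /rdf/exists_inP[u u2 vu] : v \in level f 0.
  by move: v0; rewrite !inE; case: (f v) => [[|[|[|]]]].
by apply/exists_inP; exists u; rewrite // inE u2 orbT.
Qed.

(** The two levels are disjoint and [weight] counts [level f 2] twice, so removing one copy leaves
    the size of the union. *)
Lemma card_positive_level f :
  #|level f 1 :|: level f 2| = weight f - #|level f 2|.
Proof.
rewrite /weight mul2n -addnn addnA addnK cardsU.
suff -> : level f 1 :&: level f 2 = set0 by rewrite cards0 subn0.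
by apply/setP=> v; rewrite !inE; case: eqP => // ->.
Qed.

End MinimaBounds.

(** An edge of the direct product moves both coordinates, so a neighbor is needed in each factor
    even over [A] or [D]; totality supplies both independently. *)
Lemma total_dominating_setX (G H : sgraph) (A : {set G}) (D : {set H}) :
  total_dominating A -> total_dominating D ->
  total_dominating (setX A D : {set direct_product G H}).
Proof.
move=> /forallP tdA /forallP tdD; apply/forallP=> -[x y].
have /exists_inP[u uA xu] := tdA x; have /exists_inP[w wD yw] := tdD y.
apply/exists_inP; exists (u, w); first by rewrite in_setX uA.
by rewrite /= /dprod_adj xu.
Qed.

Theorem theorem2p3 (G H : sgraph)
    (hG : no_isolated G) (hH : no_isolated H)
    (hgamma : gamma_t H = gamma H) :
  (forall f : {ffun G -> 'I_3}, TRDF f -> weight f = gamma_tR G ->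
     gamma_R (direct_product G H)
       <= 2 * gamma H * (gamma_tR G - #|level f 2|)) /\
  ((exists f : {ffun G -> 'I_3},
      [/\ TRDF f, weight f = gamma_tR G & dominating (level f 2)]) ->
   gamma_R (direct_product G H) <= 2 * gamma H * (gamma_tR G - gamma G)).
Proof.
have part_i (f : {ffun G -> 'I_3}) : TRDF f -> weight f = gamma_tR G ->
    gamma_R (direct_product G H) <= 2 * gamma H * (gamma_tR G - #|level f 2|).
  (* Trading [gamma H] for [gamma_t H] turns the bound into twice the size of a product of two total
     dominating sets. *)
  move=> trdf <-; rewrite -card_positive_level -hgamma.
  have [D tdD <-] := gamma_t_witness H hH.
  rewrite -mulnA [#|D| * _]mulnC -cardsX.
  apply: (@gamma_R_le_double (direct_product G H)).
  apply: total_dominating_dominating.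
  exact: total_dominating_setX (TRDF_total_dominating _ _ trdf) tdD.
(* Part (ii) weakens part (i): as [level f 2] dominates, [gamma G] is at most its size, and
   subtracting less gives a larger bound. *)
split=> // -[f [trdf wf dom2]]; apply: leq_trans (part_i f trdf wf) _.
by rewrite leq_mul2l leq_sub2l ?orbT // gamma_le.
Qed.
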